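(* Fix a positive integer $m$. For a real number $M\ge1$ let $\mathcal X=\{1,2,\dots,m+2\}$, let $\pi$ be the distribution on $\mathcal X$ with $\pi(1)=\frac{M}{M+m+1}$ and $\pi(x)=\frac1{M+m+1}$ for $2\le x\le m+2$, and let $P$ be the Markov kernel on $\mathcal X$ given by $P(x,y)=0$ for $|x-y|\ge2$; $P(x,x-1)=\frac14$ for $2\le x\le m+2$; $P(x,x+1)=\frac14$ for $2\le x\le m+1$; $P(1,2)=\frac1{4M}$; and diagonal entries $P(x,x)=1-\sum_{y\ne x}P(x,y)$. (Then $P$ is reversible with respect to $\pi$.) As $M\to\infty$ with $m$ fixed, $$\delta(\pi,P^m)=O\left(\frac1{\log M}\right)\qquad\text{and}\qquad \delta(\pi,P^{m+1})=\Omega(1).$$ In particular, $\frac{\delta(\pi,P^{m+1})}{\delta(\pi,P^m)}=\Omega(\log M)$.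
   Context: For a finite set $\mathcal X$, a Markov kernel $Q$ on $\mathcal X$ (row-stochastic matrix) with invariant distribution $\pi$, the full-step entropy contraction coefficient is $$\delta(\pi,Q)=1-\sup_{\nu:\,0<D(\nu\|\pi)<\infty}\frac{D(\nu Q\|\pi)}{D(\nu\|\pi)},$$ where $\nu$ ranges over probability distributions on $\mathcal X$, $(\nu Q)(y)=\sum_x\nu(x)Q(x,y)$, and $D(\nu\|\pi)=\sum_x\nu(x)\log\frac{\nu(x)}{\pi(x)}$ is the KL divergence (natural logarithm, $0\log0=0$, $+\infty$ if $\nu\not\ll\pi$). $P^m$ denotes the matrix power. The implied constants in $O,\Omega$ may depend on $m$ but not on $M$, and the bounds are for all sufficiently large $M$. *)

(* Defs.v *)
From mathcomp Require Import all_boot all_order all_algebra.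
From mathcomp Require Import all_classical all_reals all_analysis.

Set Implicit Arguments.
Unset Strict Implicit.
Unset Printing Implicit Defensive.

Import Order.TTheory GRing.Theory Num.Theory.
Local Open Scope classical_set_scope.
Local Open Scope ring_scope.

Section Entropy.
Variables (R : realType) (n : nat).
Implicit Types (p nu pi : 'rV[R]_n) (Q : 'M[R]_n).

Definition is_distr p : Prop :=
  (forall x, 0 <= p 0 x) /\ \sum_x p 0 x = 1.

Definition is_kernel Q : Prop :=
  (forall x y, 0 <= Q x y) /\ (forall x, \sum_y Q x y = 1).

Definition reversible pi Q : Prop :=
  forall x y, pi 0 x * Q x y = pi 0 y * Q y x.

(* When nu << pi, the terms with nu 0 x = 0 vanish because of the factor
   nu 0 x, whatever the values of ln 0 and of division by 0. *)
Definition kl nu pi : \bar R :=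
  if [forall x, (pi 0 x == 0) ==> (nu 0 x == 0)]
  then (\sum_x nu 0 x * ln (nu 0 x / pi 0 x))%:E
  else +oo%E.

(* For pi invariant under the kernel Q, kl (nu *m Q) pi <= kl nu pi, so that
   [fine] is applied to finite values only and the set of ratios lies in
   [0, 1]; it is nonempty as soon as pi is not a point mass, and [sup] is then
   a genuine supremum. *)
Definition contraction_ratios pi Q : set R :=
  [set fine (kl (nu *m Q) pi) / fine (kl nu pi) |
     nu in [set nu | is_distr nu /\ (0 < kl nu pi < +oo)%E]].

Definition delta pi Q : R := 1 - sup (contraction_ratios pi Q).

End Entropy.

(* The state x in {1, ..., m+2} is the ordinal of value x - 1 in 'I_m.+2. *)
Section Chain.
Variables (R : realType) (m : nat) (M : R).

Definition chain_pi : 'rV[R]_m.+2 :=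
  \row_x (if x == ord0 then M / (M + m%:R + 1) else 1 / (M + m%:R + 1)).

Definition chain_jump (x y : 'I_m.+2) : R :=
  if x == y.+1 :> nat then 1 / 4
  else if y == x.+1 :> nat then
    (if x == ord0 then 1 / (4 * M) else 1 / 4)
  else 0.

Definition chain_P : 'M[R]_m.+2 :=
  \matrix_(x, y) (if x == y then 1 - \sum_(z | z != x) chain_jump x z
                  else chain_jump x y).

End Chain.

Arguments chain_pi {R} m M.
Arguments chain_P {R} m M.

(* Main.v *)
Require Import Defs.
From mathcomp Require Import all_boot all_order all_algebra.
From mathcomp Require Import all_classical all_reals all_analysis.
From mathcomp Require Import ring lra zify.

Import Order.TTheory GRing.Theory Num.Theory.
Local Open Scope classical_set_scope.
Local Open Scope ring_scope.

(* Write nu = f pi and H(f) = sum pi f ln f.  If Q is reversible and each row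
   satisfies Q(x, .) >= eps(x) pi, Jensen's inequality applied to the mixture
   Q(x, .) = eps(x) pi + residual gains eps(x) H(f) at x, because f has mean 1
   under pi; summing, Q contracts the entropy by 1 - sum pi eps.  Every pair of
   states is at distance at most m + 1, so for P^(m+1) one may take
   eps = 4^-(m+1), uniformly in M.  For P^m only some rows qualify, such as that
   of state 2, which still gives delta > 0.  Started at the far end m + 2, the
   chain has not reached the heavy state after m steps, so the divergence is
   still ln(M + m + 1) up to an additive constant, while it started at
   ln(M + m + 1); hence delta(P^m) = O(1 / ln M). *)

(** * Convexity of t ln t *)

Section EntropyContraction.
Variable R : realType.

(** A convex function lies above its tangent at s; for t > 0 this is ln(s/t) <= s/t - 1 multiplied
    by t. *)
Lemma xlnx_tangent (s t : R) : 0 < s -> 0 <= t ->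
  s * ln s + (ln s + 1) * (t - s) <= t * ln t.
Proof.
move=> s0; rewrite le_eqVlt => /orP[/eqP<-|t0]; first by rewrite mul0r; lra.
have lnst : ln s - ln t <= s / t - 1.
  rewrite -lnV ?posrE// -lnM ?posrE ?invr_gt0// -[X in ln X](subrKC 1).
  by apply: le_ln1Dx; have := divr_gt0 s0 t0; lra.
have := ler_wpM2l (ltW t0) lnst.
by rewrite !mulrBr mulr1 mulrCA divff ?gt_eqF// mulr1; lra.
Qed.

Lemma xlnx_ge (t : R) : 0 <= t -> -1 <= t * ln t.
Proof. by move=> t0; have := @xlnx_tangent 1 t ltr01 t0; rewrite ln1; lra. Qed.

(** * Powers of reversible kernels *)

Lemma is_kernel_exp n (Q : 'M[R]_n.+1) k : is_kernel Q -> is_kernel (Q ^+ k).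
Proof.
move=> [Q0 Q1]; elim: k => [|k [IH0 IH1]].
  split=> [x y|x]; first by rewrite expr0 mxE; case: eqP.
  rewrite expr0 (bigD1 x) //= mxE eqxx big1 ?addr0// => y yx.
  by rewrite mxE eq_sym (negPf yx).
split=> [x y|x].
  by rewrite exprS -mulmxE mxE; apply: sumr_ge0 => z _; apply: mulr_ge0.
under eq_bigr do rewrite exprS -mulmxE mxE.
rewrite exchange_big -[RHS](Q1 x); apply: eq_bigr => y _.
by rewrite -mulr_sumr IH1 mulr1.
Qed.

Lemma reversible_exp n (pi : 'rV[R]_n.+1) (Q : 'M[R]_n.+1) k :
  reversible pi Q -> reversible pi (Q ^+ k).
Proof.
move=> rev; elim: k => [|k IH] x y.
  by rewrite expr0 !mxE [y == x]eq_sym; case: eqP => [->|_]; rewrite ?mulr0.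
(* Splitting off [Q] at opposite ends of the two sides uses reversibility of [Q] and of [Q ^+ k]
   once each. *)
rewrite [in LHS]exprS [in RHS]exprSr -!mulmxE !mxE !mulr_sumr.
by apply: eq_bigr => z _; rewrite mulrA rev mulrAC IH mulrA.
Qed.

(** * Entropy contraction from minorized rows *)

Section FullSupport.
Variables (n : nat) (pi : 'rV[R]_n) (Q : 'M[R]_n).
Hypotheses (pi_gt0 : forall x, 0 < pi 0 x) (pi_distr : is_distr pi).
Hypotheses (Q_kernel : is_kernel Q) (Q_rev : reversible pi Q).

Lemma kl_full nu : kl nu pi = (\sum_x nu 0 x * ln (nu 0 x / pi 0 x))%:E.
Proof.
rewrite /kl; case: ifPn => // /forallPn[x].
by rewrite gt_eqF.
Qed.

(* Jensen's inequality for the mixture of [pi], with weight [eps], and of a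
   residual measure: the former contributes [0] since [f] has mean [1]. *)
Lemma xlnx_jensen_minorized (f : 'I_n -> R) (q : 'I_n -> R) (eps : R) :
  (forall y, 0 <= f y) -> \sum_y pi 0 y * f y = 1 ->
  \sum_y q y = 1 -> 0 <= eps -> (forall y, eps * pi 0 y <= q y) ->
  (\sum_y q y * f y) * ln (\sum_y q y * f y) <=
  \sum_y q y * (f y * ln (f y)) - eps * \sum_y pi 0 y * (f y * ln (f y)).
Proof.
move=> f0 f1 q1 eps0 le_q; set s := \sum_y q y * f y.
have q0 y : 0 <= q y by apply: le_trans (le_q y); rewrite mulr_ge0// ltW.
have qf0 y : 0 <= q y * f y by rewrite mulr_ge0.
rewrite mulr_sumr -sumrB.
have : 0 <= s by apply: sumr_ge0.
(* There is no tangent at 0. If s = 0, all q f vanish, hence so do all (q - eps pi) f, and the right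
   side is 0 term by term. *)
rewrite le_eqVlt => /orP[/eqP s0|s_gt0].
  rewrite -s0 mul0r; apply: sumr_ge0 => y _.
  suff fy0 : (q y - eps * pi 0 y) * f y = 0.
    by rewrite !mulrA -mulrBl -mulrBl fy0 mul0r.
  have qy0 : q y * f y = 0.
    move/eqP: s0; rewrite eq_sym psumr_eq0// => /allP/(_ y).
    by rewrite mem_index_enum => /(_ isT)/eqP.
  apply/eqP; rewrite eq_le mulr_ge0 ?subr_ge0// andbT mulrBl qy0 sub0r oppr_le0.
  by rewrite !mulr_ge0// ltW.
(* The tangent at s is summed against the residual q - eps pi. Against q it gives s ln s; against pi
   it gives its value at 1, the mean of f, which is at most 1 ln 1 = 0 by [tan1]. *)
have := xlnx_tangent _ _ s_gt0 ler01; rewrite ln1 mulr0 => tan1.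
pose tangent y := s * ln s + (ln s + 1) * (f y - s).
apply: le_trans (_ : \sum_y (q y - eps * pi 0 y) * tangent y <= _); last first.
  apply: ler_sum => y _; rewrite [eps * (_ * _)]mulrA -mulrBl.
  by apply: ler_wpM2l; [rewrite subr_ge0|apply: xlnx_tangent].
have -> : \sum_y (q y - eps * pi 0 y) * tangent y =
  \sum_y ((ln s + 1) * (q y * f y) - s * q y + eps * s * pi 0 y
           - eps * (ln s + 1) * (pi 0 y * f y)).
  by apply: eq_bigr => y _; rewrite /tangent; ring.
rewrite sumrB !big_split /= sumrN -!mulr_sumr q1 f1 (proj2 pi_distr) -/s.
have := mulr_ge0 eps0 (_ : 0 <= - (s * ln s + (ln s + 1) * (1 - s))).
rewrite oppr_ge0 => /(_ tan1); lra.
Qed.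

(** By reversibility, nu Q has density Q f with respect to pi, so the Jensen bound applies at each x
    and is then averaged over pi. *)
Lemma kl_minorized_contraction (eps : 'I_n -> R) nu :
  (forall x, 0 <= eps x) -> (forall x y, eps x * pi 0 y <= Q x y) ->
  is_distr nu ->
  fine (kl (nu *m Q) pi) <= (1 - \sum_x pi 0 x * eps x) * fine (kl nu pi).
Proof.
move=> eps0 le_Q [nu0 nu1]; rewrite !kl_full /=.
pose f y := nu 0 y / pi 0 y.
have piN0 x : pi 0 x != 0 by rewrite gt_eqF.
have fE y : nu 0 y = pi 0 y * f y by rewrite mulrC divfK.
have nuQE x : (nu *m Q) 0 x = pi 0 x * \sum_y Q x y * f y.
  rewrite mxE mulr_sumr; apply: eq_bigr => y _.
  by rewrite mulrA Q_rev fE mulrAC.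
have f0 y : 0 <= f y by rewrite divr_ge0// ltW.
have f1 : \sum_y pi 0 y * f y = 1.
  by rewrite -nu1; apply: eq_bigr => y _; rewrite -fE.
set D := \sum_y pi 0 y * (f y * ln (f y)).
have -> : \sum_x nu 0 x * ln (nu 0 x / pi 0 x) = D.
  by apply: eq_bigr => y _; rewrite -/(f y) {1}fE mulrA.
(* Invariance of pi: applying [Q] preserves the mean under pi. *)
have DQ : \sum_x pi 0 x * (\sum_y Q x y * (f y * ln (f y))) = D.
  under eq_bigr do rewrite mulr_sumr.
  rewrite exchange_big; apply: eq_bigr => y _ /=.
  under eq_bigr do rewrite mulrA Q_rev mulrAC.
  by rewrite -mulr_sumr (proj2 Q_kernel) mulr1.
rewrite mulrBl mul1r -[X in _ <= X - _]DQ mulr_suml -sumrB.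
apply: ler_sum => x _; rewrite nuQE [X in ln X]mulrC mulKf//.
rewrite -!mulrA -mulrBr ler_pM2l//.
by apply: xlnx_jensen_minorized => //; exact: (proj2 Q_kernel).
Qed.

Lemma contraction_ratios_le (eps : 'I_n -> R) :
  (forall x, 0 <= eps x) -> (forall x y, eps x * pi 0 y <= Q x y) ->
  ubound (contraction_ratios pi Q) (1 - \sum_x pi 0 x * eps x).
Proof.
move=> eps0 le_Q _ [nu [nuD /andP[kl0 kloo]] <-].
have kl_gt0 : 0 < fine (kl nu pi) by rewrite fine_gt0// kl0.
by rewrite ler_pdivrMr//; apply: kl_minorized_contraction.
Qed.

Lemma delta_ge_minorized (eps : 'I_n -> R) :
  (forall x, 0 <= eps x) -> (forall x y, eps x * pi 0 y <= Q x y) ->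
  contraction_ratios pi Q !=set0 -> \sum_x pi 0 x * eps x <= delta pi Q.
Proof.
move=> eps0 le_Q ne; rewrite /delta lerBrDl -lerBrDr.
by apply: ge_sup => //; apply: contraction_ratios_le.
Qed.

(** * Upper bounds on [delta] from point masses *)

Lemma is_distr_delta_mx (x : 'I_n) : is_distr (delta_mx 0 x : 'rV[R]_n).
Proof.
split=> [y|]; first by rewrite mxE; case: (_ && _).
rewrite (bigD1 x) //= mxE !eqxx big1 ?addr0// => y yx.
by rewrite mxE (negPf yx) andbF.
Qed.

Lemma kl_delta_mx (x : 'I_n) : kl (delta_mx 0 x) pi = (- ln (pi 0 x))%:E.
Proof.
rewrite kl_full (bigD1 x) //= mxE !eqxx /= mul1r div1r lnV ?posrE//.
rewrite big1 ?addr0// => y yx.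
by rewrite mxE (negPf yx) andbF mul0r.
Qed.

Lemma delta_mx_ratio (x : 'I_n) : pi 0 x < 1 ->
  contraction_ratios pi Q (fine (kl (row x Q) pi) / (- ln (pi 0 x))).
Proof.
move=> pix; exists (delta_mx 0 x); last by rewrite kl_delta_mx rowE.
split; first exact: is_distr_delta_mx.
by rewrite kl_delta_mx ltry andbT lte_fin oppr_gt0 ln_lt0// pi_gt0.
Qed.

(** In the divergence, each of the n terms q ln q is at least -1, and - ln pi(y) >= - ln pi(x)
    wherever the row has mass. *)
Lemma kl_row_ge (x : 'I_n) : (forall y, Q x y != 0 -> pi 0 y <= pi 0 x) ->
  - ln (pi 0 x) - n%:R <= fine (kl (row x Q) pi).
Proof.
move=> le_pi; rewrite kl_full /=.
have -> : - ln (pi 0 x) - n%:R = \sum_y (- ln (pi 0 x) * Q x y - 1).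
  by rewrite sumrB -mulr_sumr (proj2 Q_kernel) mulr1 sumr_const card_ord.
apply: ler_sum => y _; rewrite mxE.
have := proj1 Q_kernel x y; rewrite le_eqVlt => /orP[/eqP<-|Qxy].
  by rewrite mulr0 mul0r; lra.
have lnpi : ln (pi 0 y) <= ln (pi 0 x) by rewrite ler_ln ?posrE// le_pi// gt_eqF.
have := xlnx_ge _ (ltW Qxy); rewrite lnM ?posrE ?invr_gt0// lnV ?posrE//.
have := ler_wpM2l (ltW Qxy) lnpi; lra.
Qed.

Lemma delta_le_point_mass (x : 'I_n) : pi 0 x < 1 ->
  (forall y, Q x y != 0 -> pi 0 y <= pi 0 x) ->
  delta pi Q <= n%:R / (- ln (pi 0 x)).
Proof.
move=> pix le_pi; rewrite /delta lerBlDl -lerBlDr.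
have lnx : 0 < - ln (pi 0 x) by rewrite oppr_gt0 ln_lt0// pi_gt0.
apply: (@le_trans _ _ (fine (kl (row x Q) pi) / - ln (pi 0 x))); last first.
  apply: ub_le_sup; last exact: delta_mx_ratio.
  (* Taking eps = 0 bounds every ratio by 1, so the supremum is genuine and dominates the ratio at
     the point mass. *)
  exists (1 - \sum_x pi 0 x * 0);
  apply: (contraction_ratios_le (fun=> 0)) => // y z.
  by rewrite mul0r (proj1 Q_kernel).
rewrite ler_pdivlMr// mulrBl mul1r divfK ?gt_eqF//.
exact: kl_row_ge.
Qed.

End FullSupport.
End EntropyContraction.

(** * The chain: stationary law, kernel, reversibility *)

Section BirthDeathChain.
Variables (R : realType) (m : nat) (M : R).
Hypothesis M_ge1 : 1 <= M.

Let pi := chain_pi m M.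
Let P := chain_P m M.

Let M_gt0 : 0 < M. Proof. exact: lt_le_trans M_ge1. Qed.

Let Z_gt0 : 0 < M + m%:R + 1.
Proof. by have := ler0n R m; move: M_gt0; lra. Qed.

Lemma chain_pi0 : pi 0 ord0 = M / (M + m%:R + 1).
Proof. by rewrite mxE eqxx. Qed.

Lemma chain_piS x : x != ord0 -> pi 0 x = (M + m%:R + 1)^-1.
Proof. by move=> x0; rewrite mxE (negPf x0) div1r. Qed.

Lemma chain_pi_gt0 x : 0 < pi 0 x.
Proof. by rewrite mxE; case: ifP => _; rewrite divr_gt0. Qed.

Lemma chain_pi_distr : is_distr pi.
Proof.
split=> [x|]; first exact/ltW/chain_pi_gt0.
rewrite big_ord_recl chain_pi0.
under eq_bigr do rewrite chain_piS//.
rewrite sumr_const card_ord -[X in _ + X]mulr_natl -mulrDl -natr1 addrA.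
by rewrite divff// gt_eqF.
Qed.

Lemma chain_pi_le1 x : pi 0 x <= 1.
Proof.
rewrite -(proj2 chain_pi_distr) (bigD1 x) //= lerDl.
by apply: sumr_ge0 => y _; exact/ltW/chain_pi_gt0.
Qed.

Lemma chain_jump_ge0 (x y : 'I_m.+2) : 0 <= chain_jump M x y :> R.
Proof.
rewrite /chain_jump; case: ifP => _; first lra.
by case: ifP => // _; case: ifP => _; rewrite divr_ge0// mulr_ge0// ltW.
Qed.

(** Uniform in M because 1/(4M) <= 1/4; the two indicators, of the lower and the upper neighbour,
    are easily summed over a row. *)
Lemma chain_jump_le (x y : 'I_m.+2) :
  chain_jump M x y <=
  1 / 4 * (x == y.+1 :> nat)%:R + 1 / 4 * (y == x.+1 :> nat)%:R :> R.
Proof.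
rewrite /chain_jump; case: ifP => _; first by rewrite mulr1 lerDl mulr_ge0.
case: ifP => _; last by rewrite !mulr0; lra.
case: ifP => _; rewrite mulr0 mulr1 ?add0r//.
by rewrite ler_pM2l// lef_pV2 ?posrE ?mulr_gt0// ler_peMr.
Qed.

Lemma sum_pred_le1 n (p : pred 'I_n) :
  (forall x y, p x -> p y -> x = y) -> \sum_x (p x)%:R <= 1 :> R.
Proof.
move=> p_inj; case: (pickP p) => [x px|p0]; last first.
  by rewrite big1// => x _; rewrite p0.
rewrite (bigD1 x) //= px big1 ?addr0// => y /eqP yx.
by case: (boolP (p y)) => // py; case: yx; exact: p_inj.
Qed.

(** At most one neighbour on each side, each reached with probability at most 1/4. This laziness
    later lets a path wait at its target. *)
Lemma chain_P_diag_ge x : 1 / 2 <= P x x.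
Proof.
rewrite mxE eqxx lerBrDr -lerBrDl.
pose jump_bound (z : 'I_m.+2) : R :=
  1 / 4 * (x == z.+1 :> nat)%:R + 1 / 4 * (z == x.+1 :> nat)%:R.
apply: le_trans (_ : \sum_z jump_bound z <= _).
  rewrite [leRHS](bigID (fun z => z != x)) /=.
  apply: le_trans (_ : \sum_(z | z != x) jump_bound z <= _).
    by apply: ler_sum => z _; exact: chain_jump_le.
  by rewrite lerDl; apply: sumr_ge0 => z _; rewrite addr_ge0// mulr_ge0//; lra.
rewrite big_split /= -!mulr_sumr.
have h1 : \sum_(z < m.+2) (x == z.+1 :> nat)%:R <= 1 :> R.
  by apply: sum_pred_le1 => y z /eqP-> /eqP[yz]; exact: val_inj.
have h2 : \sum_(z < m.+2) (z == x.+1 :> nat)%:R <= 1 :> R.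
  by apply: sum_pred_le1 => y z /eqP yx /eqP zx; apply: val_inj => /=; rewrite yx zx.
lra.
Qed.

Lemma chain_P_kernel : is_kernel P.
Proof.
split=> [x y|x].
  have [->|xy] := eqVneq x y; first by have := chain_P_diag_ge y; lra.
  by rewrite mxE (negPf xy) chain_jump_ge0.
rewrite (bigD1 x) //= mxE eqxx -[RHS](subrK (\sum_(z | z != x) chain_jump M x z)).
congr (_ + _); apply: eq_bigr => y; rewrite mxE eq_sym => /negPf.
by rewrite eq_sym => ->.
Qed.

(** Up to normalisation each edge carries flow 1/4 both ways: the weight M of the heavy state
    cancels its rate 1/(4M). *)
Lemma chain_P_rev : reversible pi P.
Proof.
move=> x y; have [->//|xy] := eqVneq x y.
rewrite !mxE (negPf xy) [y == x]eq_sym (negPf xy) /chain_jump.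
have MN0 : M != 0 by rewrite gt_eqF.
have ZN0 : M + m%:R + 1 != 0 by rewrite gt_eqF.
have [xy1|xy1] := eqVneq (x : nat) y.+1.
  have -> : (y == x.+1 :> nat) = false by lia.
  have -> : (x == ord0) = false by apply/negbTE/eqP => x0; move: xy1; rewrite x0.
  by case: (y == ord0); field; rewrite ?MN0 ?ZN0.
have [yx1|yx1] := eqVneq (y : nat) x.+1; last by rewrite !mulr0.
have -> : (y == ord0) = false by apply/negbTE/eqP => y0; move: yx1; rewrite y0.
by case: (x == ord0); field; rewrite ?MN0 ?ZN0.
Qed.

(** * Paths and the entries of the powers of [P] *)

Lemma chain_P_step (x y : 'I_m.+2) : (x != ord0) || (y == ord0) ->
  (x <= y.+1)%N -> (y <= x.+1)%N -> 1 / 4 <= P x y.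
Proof.
move=> x0 xy yx; have [->|neq] := eqVneq x y; first by have := chain_P_diag_ge y; lra.
rewrite mxE (negPf neq) /chain_jump; case: ifP => // /eqP xy1.
have yx1 : (y : nat) = x.+1 by move: neq; rewrite -val_eqE /=; lia.
rewrite yx1 eqxx; case: ifP => // xE; move: x0; rewrite xE /= => /eqP y0.
by move: yx1; rewrite y0.
Qed.

(** Walk straight from x to y, then wait there. This path never jumps out of the heavy state, the
    one move whose probability 1/(4M) has no lower bound uniform in M. *)
Lemma chain_P_exp_ge k (x y : 'I_m.+2) : (x != ord0) || (y == ord0) ->
  (x <= y + k)%N -> (y <= x + k)%N -> (1 / 4) ^+ k <= (P ^+ k) x y.
Proof.
elim: k x => [|k IH] x x0 xy yx.
  have -> : x = y by apply: val_inj => /=; lia.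
  by rewrite !expr0 mxE eqxx.
(* Only the paths whose first move is to z are kept. *)
have step (z : 'I_m.+2) : (x <= z.+1)%N -> (z <= x.+1)%N -> (x != ord0) || (z == ord0) ->
    (z != ord0) || (y == ord0) -> (z <= y + k)%N -> (y <= z + k)%N ->
    (1 / 4) ^+ k.+1 <= (P ^+ k.+1) x y.
  move=> xz zx xz0 z0 zy yz; rewrite [in leRHS]exprS -mulmxE mxE (bigD1 z) //=.
  have [Pk0 _] := is_kernel_exp _ _ _ k chain_P_kernel.
  apply: le_trans (_ : P x z * (P ^+ k) z y <= _).
    by rewrite exprS; apply: ler_pM; rewrite ?exprn_ge0// ?chain_P_step ?IH//; lra.
  by rewrite lerDl; apply: sumr_ge0 => t _; rewrite mulr_ge0// (proj1 chain_P_kernel).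
have val0 (t : 'I_m.+2) : (t == ord0) = (t == 0 :> nat) by [].
have lx := ltn_ord x; have ly := ltn_ord y; rewrite !val0 in x0.
have [xy'|yx'|xyE] := ltngtP x y.
- by apply: (step (inord x.+1)); rewrite ?val0 ?inordK//; lia.
- by apply: (step (inord x.-1)); rewrite ?val0 ?inordK//; lia.
- by apply: (step x); rewrite ?val0//; lia.
Qed.

(** The factor pi(y) pays for leaving the heavy state: in that case the path from y to x is
    reversed, and pi(x) <= 1. *)
Lemma chain_P_exp_minorized k (x y : 'I_m.+2) : (x <= y + k)%N -> (y <= x + k)%N ->
  (1 / 4) ^+ k * pi 0 y <= (P ^+ k) x y.
Proof.
move=> xy yx; have c0 : 0 <= (1 / 4 : R) ^+ k by rewrite exprn_ge0//; lra.
have [x0|x0] := boolP ((x != ord0) || (y == ord0)).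
  by apply: le_trans (chain_P_exp_ge k x y x0 xy yx); rewrite ler_piMr// chain_pi_le1.
move: x0; rewrite negb_or negbK => /andP[x0 y0].
have := reversible_exp _ _ _ _ k chain_P_rev x y => rev.
have : (1 / 4) ^+ k <= (P ^+ k) y x by apply: chain_P_exp_ge => //; rewrite x0 orbT.
rewrite -(ler_pM2l (chain_pi_gt0 y)) -rev mulrC => /le_trans; apply.
by rewrite ler_piMl ?chain_pi_le1// (proj1 (is_kernel_exp _ _ _ k chain_P_kernel)).
Qed.

(** Each step lowers the state by at most one. *)
Lemma chain_P_exp_eq0 k (x y : 'I_m.+2) : (y + k < x)%N -> (P ^+ k) x y = 0.
Proof.
elim: k x => [|k IH] x yx.
  by rewrite expr0 mxE; case: eqP => // xy; move: yx; rewrite xy; lia.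
rewrite exprS -mulmxE mxE big1// => z _.
have [zx|zx] := ltnP (y + k) z; first by rewrite IH// mulr0.
rewrite mxE /chain_jump.
have -> : (x == z) = false by apply/eqP => xz; move: yx; rewrite xz; lia.
have -> : (x == z.+1 :> nat) = false by lia.
have -> : (z == x.+1 :> nat) = false by lia.
by rewrite mul0r.
Qed.

(** * Bounds on [delta] for the powers [m] and [m.+1] *)

Lemma chain_pi_max : pi 0 ord_max = (M + m%:R + 1)^-1.
Proof. by rewrite chain_piS. Qed.

Lemma chain_pi_max_lt1 : pi 0 ord_max < 1.
Proof.
by rewrite chain_pi_max invf_lt1//; have := ler0n R m; move: M_gt0; lra.
Qed.

Lemma chain_ratios_neq0 k : contraction_ratios pi (P ^+ k) !=set0.
Proof.
by eexists; apply: (delta_mx_ratio _ _ _ _ chain_pi_gt0 ord_max chain_pi_max_lt1).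
Qed.

Lemma chain_delta_expS_ge : (1 / 4) ^+ m.+1 <= delta pi (P ^+ m.+1).
Proof.
have -> : (1 / 4) ^+ m.+1 = \sum_x pi 0 x * (1 / 4) ^+ m.+1 :> R.
  by rewrite -mulr_suml (proj2 chain_pi_distr) [RHS]mul1r.
apply: (delta_ge_minorized _ _ _ _ chain_pi_gt0 chain_pi_distr
  (is_kernel_exp _ _ _ m.+1 chain_P_kernel)
  (reversible_exp _ _ _ _ m.+1 chain_P_rev) (fun=> (1 / 4) ^+ m.+1)).
- by move=> x; rewrite exprn_ge0//; lra.
- by move=> x y; apply: chain_P_exp_minorized;
    have := ltn_ord x; have := ltn_ord y; lia.
- exact: chain_ratios_neq0.
Qed.

(* State 2 reaches every state within [m] steps, so its row alone already
   yields a strict contraction. *)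
Lemma chain_delta_exp_gt0 : (0 < m)%N -> 0 < delta pi (P ^+ m).
Proof.
move=> m_gt0; pose x1 : 'I_m.+2 := inord 1.
pose eps (x : 'I_m.+2) : R := if x == x1 then (1 / 4) ^+ m else 0.
have c0 : 0 < (1 / 4 : R) ^+ m by rewrite exprn_gt0//; lra.
apply: (@lt_le_trans _ _ (\sum_x pi 0 x * eps x)).
  rewrite (bigD1 x1) //= /eps eqxx big1 => [|x /negPf->]; last by rewrite mulr0.
  by rewrite addr0 mulr_gt0// chain_pi_gt0.
apply: (delta_ge_minorized _ _ _ _ chain_pi_gt0 chain_pi_distr
  (is_kernel_exp _ _ _ m chain_P_kernel)
  (reversible_exp _ _ _ _ m chain_P_rev) eps).
- by move=> x; rewrite /eps; case: ifP => // _; exact: ltW.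
- move=> x y; rewrite /eps; case: ifP => [/eqP->|_]; last first.
    by rewrite mul0r (proj1 (is_kernel_exp _ _ _ m chain_P_kernel)).
  (* Index 1 is at distance m from index m + 1, and at distance 1 <= m from index 0. *)
  by apply: chain_P_exp_minorized; have := ltn_ord y; rewrite inordK//; lia.
- exact: chain_ratios_neq0.
Qed.

(** From the far end, m steps fall one short of the heavy state, so every state reached has the same
    weight as [ord_max]. The factor m + 2 counts the states, and ln(M + m + 1) is weakened to ln
    M. *)
Lemma chain_delta_exp_le : 1 < M -> delta pi (P ^+ m) <= m.+2%:R * (1 / ln M).
Proof.
move=> M1; apply: (le_trans (delta_le_point_mass _ _ _ _ chain_pi_gt0 chain_pi_distr
  (is_kernel_exp _ _ _ m chain_P_kernel) (reversible_exp _ _ _ _ m chain_P_rev)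
  ord_max chain_pi_max_lt1 _)) => [y|].
  rewrite chain_pi_max; have [->|y0] := eqVneq y ord0; last by rewrite chain_piS.
  by rewrite chain_P_exp_eq0 ?eqxx//= add0n.
rewrite chain_pi_max lnV ?posrE// opprK div1r ler_pM2l// lef_pV2 ?posrE ?ln_gt0//.
- by rewrite ler_ln ?posrE//; have := ler0n R m; lra.
- by have := ler0n R m; lra.
Qed.

End BirthDeathChain.

Theorem proposition19 (R : realType) (m : nat) (m_gt0 : (0 < m)%N) :
  [/\ (forall M : R, 1 <= M ->
         [/\ is_distr (chain_pi m M), is_kernel (chain_P m M)
           & reversible (chain_pi m M) (chain_P m M)]),
      (exists2 C : R, 0 < C &
         \forall M \near +oo,
           `|delta (chain_pi m M) (chain_P m M ^+ m)| <= C * (1 / ln M)),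
      (exists2 c : R, 0 < c &
         \forall M \near +oo,
           c <= delta (chain_pi m M) (chain_P m M ^+ m.+1))
    & (exists2 c : R, 0 < c &
         \forall M \near +oo,
           c * ln M <= delta (chain_pi m M) (chain_P m M ^+ m.+1)
                       / delta (chain_pi m M) (chain_P m M ^+ m))].
Proof.
have c_gt0 : 0 < (1 / 4 : R) ^+ m.+1 by rewrite exprn_gt0//; lra.
have M_gt1 : \forall M \near +oo, (1 : R) < M by exact: nbhs_pinfty_gt.
split.
- move=> M M1; split;
    [exact: chain_pi_distr|exact: chain_P_kernel|exact: chain_P_rev].
- exists m.+2%:R => //; apply: filterS M_gt1 => M M1.
  by rewrite ger0_norm ?chain_delta_exp_le ?ltW ?chain_delta_exp_gt0 ?ltW.
- exists ((1 / 4) ^+ m.+1) => //; apply: filterS M_gt1 => M M1.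
  by rewrite chain_delta_expS_ge ?ltW.
(* The quotient of the constants in the two preceding bounds. *)
- exists ((1 / 4) ^+ m.+1 / m.+2%:R); first by rewrite divr_gt0.
  apply: filterS M_gt1 => M M1.
  have d_gt0 := chain_delta_exp_gt0 R m M (ltW M1) m_gt0.
  have lnM : 0 < ln M by rewrite ln_gt0.
  rewrite ler_pdivlMr//.
  apply: le_trans (chain_delta_expS_ge R m M (ltW M1)).
  have := chain_delta_exp_le R m M (ltW M1) M1.
  rewrite div1r ler_pdivlMr// -mulrA -mulrA ger_pMr//.
  by rewrite ler_pdivrMl// mulr1 mulrC.
Qed.
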